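(* For any positive integers $r,n$, the matrices $\boldsymbol{Z}_n$ and $\boldsymbol{C}_{n,r}$ defined in the context satisfy $$\boldsymbol{Z}_n^{-1}\,\boldsymbol{C}_{n,r}\,\boldsymbol{Z}_n=\mathrm{diag}(r,r^2,\ldots,r^n).$$
   Context: Binomial coefficients $\binom{m}{n}$ of non-negative integers are $0$ when $m<n$. $\mathfrak{S}_n$ is the symmetric group of degree $n$. For a permutation $\sigma\in\mathfrak{S}_i$, $\mathrm{des}(\sigma)=|\{1\le m\le i-1:\sigma(m)>\sigma(m+1)\}|$. The Eulerian polynomial is $E_i(t)=\sum_{\sigma\in\mathfrak{S}_i}t^{\mathrm{des}(\sigma)}$. $\boldsymbol{Z}_n=(z^n_{i,j})_{1\le i,j\le n}$ is the $n\times n$ matrix whose entries are defined by the polynomial identities $$E_i(t)(1-t)^{n-i}=\sum_{j=1}^{n}z^n_{j,i}\,t^{j-1},\qquad i=1,\ldots,n;$$ it is the change-of-basis matrix between the bases $\{t^i: 0\le i<n\}$ and $\{E_i(t)(1-t)^{n-i}: 1\le i\le n\}$ of the $\mathbb{Q}$-vector space of polynomials in $t$ of degree less than $n$, hence invertible. Foulkes characters: for $U\subseteq\{1,\ldots,n-1\}$, the ribbon shape $R(U)$ is the skew shape with $n$ boxes obtained by starting with a single box and, for $i=1,\ldots,n-1$ in order, adding the next box directly below the last box if $i\in U$, and directly to the left of the last box if $i\notin U$; $\chi^{R(U)}$ is the corresponding skew character of $\mathfrak{S}_n$. For $i=1,\ldots,n$ the Foulkes character is $\phi_i^n=\sum_{|U|=n-i}\chi^{R(U)}$,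 so that $\phi_1^n$ is the alternating (sign) character and $\phi_n^n$ the trivial character. The characters $\phi_1^n,\ldots,\phi_n^n$ form a basis of the space of class functions on $\mathfrak{S}_n$ that depend only on the number of cycles, and the coefficients $c_{i,j,k}^n$ ($1\le i,j,k\le n$) are defined by $$\phi_i^n\phi_j^n=\sum_{k=1}^n c_{i,j,k}^n\,\phi_k^n .$$ $\boldsymbol{C}_{n,r}=(c_{i,k}^{n,r})_{1\le i,k\le n}$ is the $n\times n$ matrix with entries $$c_{i,k}^{n,r}=\sum_{j=1}^{n}c_{i,j,n+1-k}^{n}\binom{r-1+j}{n}.$$
   Formalization: The entry of C_{n,r} is corrected to the sum over j of c_{n+1-i,j,n+1-k} binom(r-1+j,n), in place of c_{i,j,n+1-k}; as printed, C_{n,1} is the antidiagonal matrix, so the claim fails for every n ≥ 2. *)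

(* Defs.v *)
From mathcomp Require Import all_boot all_order all_algebra all_fingroup.
From mathcomp Require Import all_solvable all_field all_character.

Set Implicit Arguments.
Unset Strict Implicit.
Unset Printing Implicit Defensive.

Import Order.TTheory GRing.Theory Num.Theory.
Local Open Scope ring_scope.

(* Throughout, indices 1, ..., n are represented by i : 'I_n standing for     *)
(* i.+1, so that n + 1 - i is represented by rev_ord i.                       *)

Definition des (i : nat) (s : 'S_i) : nat :=
  #|[set m : 'I_i * 'I_i | (m.2 == m.1.+1 :> nat) && (s m.2 < s m.1)%N]|.

Definition eulerian (i : nat) : {poly algC} := \sum_(s : 'S_i) 'X^(des s).

(* The entry in row j and column i is the coefficient of t^(j-1) in           *)
(* E_i(t) (1 - t)^(n-i), a polynomial of degree less than n.                  *)
Definition Zmx (n : nat) : 'M[algC]_n :=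
  \matrix_(j < n, i < n) (eulerian i.+1 * (1 - 'X) ^+ (n - i.+1))`_j.

Section SkewCharacter.

(* A shape with n boxes, given by the (row, column) coordinates of its boxes  *)
(* (rows numbered downwards, columns rightwards), equipped with the tableau   *)
(* whose entry in the m-th box is m.                                          *)
Variables (n : nat) (box : 'I_n -> int * int).

Definition row_stab : {set 'S_n} :=
  [set p : 'S_n | [forall m, (box (p m)).1 == (box m).1]].

Definition col_stab : {set 'S_n} :=
  [set q : 'S_n | [forall m, (box (q m)).2 == (box m).2]].

Let SnG := [set: 'S_n]%G.
Let reg := regular_repr algC SnG.

(* The polytabloid: the element                                               *)
(*   (\sum_(p in row_stab) p) * (\sum_(q in col_stab) sgn(q) q)               *)
(* of the group algebra. MathComp multiplies permutations from left to right  *)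
(* and the regular representation is by right multiplication, so the first    *)
(* factor stands for the tabloid and the second one acts on it.               *)
Definition polytabloid : 'rV[algC]_#|SnG| :=
  gring_row ((\sum_(p in row_stab) reg p) *m
             (\sum_(q in col_stab) (-1) ^+ (q : bool) *: reg q)).

(* The Specht module of the shape is the cyclic module generated by the       *)
(* polytabloid. When the shape is a skew diagram this is the skew Specht      *)
(* module, and its character is the skew character of the shape.              *)
Definition skew_char : 'CF([set: 'S_n]) :=
  cfRepr (submod_repr (cyclic_mx_module reg polytabloid)).

End SkewCharacter.

(* box m is the position of the (m+1)-st box of the ribbon. *)
Fixpoint ribbon_box (U : pred nat) (m : nat) : int * int :=
  if m is i.+1 then
    let: (r, c) := ribbon_box U i in
    if U i.+1 then (r + 1, c) else (r, c - 1)
  else (0, 0).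

(* A subset of {1, ..., n-1} is represented by U : {set 'I_n.-1}, where       *)
(* u \in U stands for u.+1.                                                   *)
Definition ribbon_char (n : nat) (U : {set 'I_n.-1}) : 'CF([set: 'S_n]) :=
  skew_char (fun m : 'I_n =>
    ribbon_box [pred i : nat | [exists u in U, i == u.+1]] m).

Definition foulkes (n : nat) (i : 'I_n) : 'CF([set: 'S_n]) :=
  \sum_(U : {set 'I_n.-1} | #|U| == (n - i.+1)%N) ribbon_char U.

(* The coefficient of phi_k in phi_i * phi_j, in the basis phi_1, ..., phi_n. *)
Definition foulkes_coef (n : nat) (i j k : 'I_n) : algC :=
  coord [tuple foulkes m | m < n] k (foulkes i * foulkes j).

(* The entry (i, k) is                                                        *)
(*   \sum_j c_{n+1-i, j, n+1-k} * binom(r-1+j, n).                            *)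
(* Both matrix indices have to be reversed in the coefficient c: column m of  *)
(* Zmx lists the values of phi_n, ..., phi_1 at a permutation with m cycles.  *)
(* As phi_{n+1-i} = sgn * phi_i, the coefficient also equals c_{i, j, k}.     *)
(* With c_{i, j, n+1-k} in its place, r = 1 would give the antidiagonal       *)
(* permutation matrix, which is not similar to the identity when n > 1.       *)
Definition Cmx (n r : nat) : 'M[algC]_n :=
  \matrix_(i < n, k < n)
    \sum_(j < n) foulkes_coef (rev_ord i) j (rev_ord k)
                 * ('C(r - 1 + j.+1, n))%:R.

(* Main.v *)
Require Import Defs.
From mathcomp Require Import all_boot all_order all_algebra all_fingroup.
From mathcomp Require Import all_solvable all_field all_character.
From mathcomp Require Import zify.
Import GRing.Theory Num.Theory.
Local Open Scope ring_scope.
Set Implicit Arguments.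
Unset Strict Implicit.
Unset Printing Implicit Defensive.

(* Solomon's decomposition of the group algebra of the symmetric group yields *)
(* the ribbon characters: the indicator functions of the cosets               *)
(* S_(Des w) w, S_K being the Young subgroup with block boundaries K, form a  *)
(* basis of the functions on the group (unitriangular for the lexicographic   *)
(* order), those with Des w in V span the left S_V-invariant functions, and   *)
(* the antisymmetriser of the columns of the ribbon R(U) kills those with     *)
(* Des w strictly contained in U. Hence chi^R(U)(g) is the trace T_U(g) of    *)
(* the block of g on the indices w with Des w = U, and the sum of the T_U(g)  *)
(* over U in V is the permutation character of S_V. Counting the colourings   *)
(* with r colours that are constant on the cycles of g according to their     *)
(* sorted rearrangement then gives                                            *)
(*   sum_U T_U(g) binom(r - 1 + n - |U|, n) = r^(number of cycles of g).      *)
(* For g = 1, this is Worpitzky's identity. These values for all r determine  *)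
(* the polynomial sum_U T_U(g) t^|U| as E_m(t) (1 - t)^(n-m), m being the     *)
(* number of cycles of g: column m of Z_n lists the values at g of the        *)
(* Foulkes characters, and it is an eigenvector of C_(n,r) because            *)
(* sum_j phi_j(g) binom(r - 1 + j, n) = r^m.                                  *)

(** The theorem amounts to [Cmx_mul_Zmx] together with the invertibility of [Zmx n] ([Zmx_unit]). By
    [foulkes_rev], [Zmx n] is the table of Foulkes character values, with columns indexed by numbers
    of cycles; the structure constants c then make C_(n,r) act on the column of g as multiplication
    by sum_j phi_j(g) binom(r - 1 + j, n), which equals r^(number of cycles of g).

    That evaluation is the real content. The skew Specht module of R(U) is the row space of
    [specht_mx U] ([specht_mx_cyclic]), and its trace is read off the diagonal block of Solomon's
    basis ([mxtrace_specht_submod]). Summing blocks over the subsets of V gives the permutation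
    character of S_V ([sum_descent_trace]), and sorting colourings converts this into
    [sum_descent_trace_bin]. Finally [bin_form_inj] inverts the binomial sums, which gives
    [trace_polyE]. *)

Lemma trivial_kernel_row_free (F : fieldType) m n (A : 'M[F]_(m, n)) :
  (forall u : 'rV_m, u *m A = 0 -> u = 0) -> row_free A.
Proof.
move=> kerA; rewrite -kermx_eq0; apply/rowV0P => v /sub_kermxP; exact: kerA.
Qed.

(** Strong induction on [ell j]: besides u_j, column j of the equation u A = 0 involves only entries
    u_i of smaller [ell], already known to vanish. *)
Lemma triangular_unitmx (F : fieldType) n (ell : 'I_n -> nat) (A : 'M[F]_n) :
  (forall i, A i i != 0) ->
  (forall i j, i != j -> A i j != 0 -> (ell i < ell j)%N) -> A \in unitmx.
Proof.
move=> Adiag Atri; rewrite -row_free_unit.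
apply: trivial_kernel_row_free => u uA0; apply/rowP => j; rewrite mxE.
have [m lejm] := ubnP (ell j); elim: m j lejm => // m IHm j lejm.
move/rowP/(_ j): uA0; rewrite !mxE (bigD1 j) //= big1 => [|i nij].
  by rewrite addr0 => /eqP; rewrite mulf_eq0 (negPf (Adiag j)) orbF => /eqP.
have [-> | nzA] := eqVneq (A i j) 0; first by rewrite mulr0.
by rewrite IHm ?mul0r // (leq_trans (Atri i j nij nzA)).
Qed.

(** * The lexicographic order on permutations *)

Section LexOrder.

Variable n : nat.
Implicit Types w x y : 'S_n.

Definition lex_lt x y :=
  [exists i : 'I_n, [forall (j : 'I_n | (j < i)%N), x j == y j] && (x i < y i)%N].

Lemma lex_ltP x y :
  reflect (exists2 i : 'I_n, forall j : 'I_n, (j < i)%N -> x j = y j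
                           & (x i < y i)%N) (lex_lt x y).
Proof.
apply: (iffP existsP) => [[i /andP[/forall_inP eq_xy lt_xy]] | [i eq_xy lt_xy]].
  by exists i => // j /eq_xy/eqP.
by exists i; rewrite lt_xy andbT; apply/forall_inP => j /eq_xy->.
Qed.

Lemma lex_ltxx x : lex_lt x x = false.
Proof. by apply/lex_ltP => -[i _]; rewrite ltnn. Qed.

Lemma lex_lt_trans : transitive lex_lt.
Proof.
move=> y x z /lex_ltP[i eq_xy lt_xy] /lex_ltP[j eq_yz lt_yz]; apply/lex_ltP.
case: (ltngtP i j) => [lt_ij | lt_ji | /val_inj eq_ij].
- exists i => [k lt_ki|]; last by rewrite -eq_yz.
  by rewrite eq_xy // eq_yz // (ltn_trans lt_ki).
- exists j => [k lt_kj|]; last by rewrite eq_xy.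
  by rewrite eq_xy ?eq_yz // (ltn_trans lt_kj).
- exists i => [k lt_ki|]; first by rewrite eq_xy // eq_yz // -eq_ij.
  by rewrite (ltn_trans lt_xy) // eq_ij.
Qed.

(** A numerical height, used as the weight [ell] of [triangular_unitmx] and as an induction
    measure. *)
Definition lex_rank y := #|[set x | lex_lt x y]|.

Lemma lex_rank_lt x y : lex_lt x y -> (lex_rank x < lex_rank y)%N.
Proof.
move=> lt_xy; apply/proper_card/properP; split.
  by apply/subsetP => z; rewrite !inE => /lex_lt_trans; apply.
by exists x; rewrite !inE ?lex_ltxx.
Qed.

End LexOrder.

(** * Young subgroups and descent sets *)

Section Blocks.

Variable N : nat.
Implicit Types (K U V : {set 'I_N}) (w p : 'S_N.+1) (i j : 'I_N.+1).

Definition block_index K (m : nat) : nat := #|[set u in K | (u < m)%N]|.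

(* K is the set of block boundaries: u \in K separates the positions u and   *)
(* u.+1, so that block_stab set0 is the whole group.                          *)
Definition block_stab K : {set 'S_N.+1} :=
  [set p : 'S_N.+1 | [forall i : 'I_N.+1, block_index K (p i) == block_index K i]].

Definition descents w : {set 'I_N} :=
  [set u : 'I_N | (w (lift ord0 u) < w (widen_ord (leqnSn N) u))%N].

Lemma block_index0 K : block_index K 0 = 0%N.
Proof. by apply/eqP; rewrite cards_eq0; apply/eqP/setP => u; rewrite !inE andbF. Qed.

Lemma block_indexS K (u : 'I_N) :
  block_index K u.+1 = (block_index K u + (u \in K))%N.
Proof.
rewrite /block_index; case: (boolP (u \in K)) => Ku.
  rewrite (cardsD1 u) !inE Ku ltnSn addnC; congr (_ + _)%N.
  apply: eq_card => v; rewrite !inE ltnS -val_eqE /=.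
  by case: (v \in K) => /=; rewrite ?andbF // ltn_neqAle.
rewrite addn0; apply: eq_card => v; rewrite !inE ltnS leq_eqVlt.
by have [/val_inj-> | //] := eqVneq (v : nat) u; rewrite (negPf Ku).
Qed.

Lemma leq_block_index K (m1 m2 : nat) : (m1 <= m2)%N ->
  (block_index K m1 <= block_index K m2)%N.
Proof.
move=> le_m; apply/subset_leq_card/subsetP => u; rewrite !inE => /andP[-> /=].
by move/leq_trans; apply.
Qed.

Lemma block_index_max K : block_index K N = #|K|.
Proof. by apply: eq_card => u; rewrite !inE ltn_ord andbT. Qed.

(** Equal block indices mean that no step from i to j crosses a boundary, so the relation propagates
    by transitivity. It serves for functions that increase, decrease or are constant on blocks. *)
Lemma homo_same_block K (e : rel nat) (f : 'I_N.+1 -> nat) : transitive e ->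
  (forall u : 'I_N, u \notin K -> e (f (widen_ord (leqnSn N) u)) (f (lift ord0 u))) ->
  forall i j, (i < j)%N -> block_index K i = block_index K j -> e (f i) (f j).
Proof.
move=> e_tr step i j; case: j => j ltjN /=.
elim: j ltjN => // j IHj ltjN; rewrite ltnS => le_ij.
have le_Kij := leq_block_index K le_ij.
pose u : 'I_N := Ordinal (ltjN : (j < N)%N).
rewrite (block_indexS K u) /= => eqK.
have notKu : u \notin K by apply/negP => Ku; rewrite Ku in eqK; lia.
have := step u notKu.
rewrite (_ : lift ord0 u = Ordinal ltjN); last exact/val_inj.
move: le_ij; rewrite leq_eqVlt => /orP[/eqP eq_ij | lt_ij] step_u.
  by rewrite (_ : i = widen_ord (leqnSn N) u) //; apply/val_inj.
have ltjN' : (j < N.+1)%N by lia.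
apply: e_tr (IHj ltjN' lt_ij _) _; first by rewrite eqK (negPf notKu) addn0.
by rewrite (_ : Ordinal ltjN' = widen_ord (leqnSn N) u) //; apply/val_inj.
Qed.

Lemma block_stabP K p :
  reflect (forall i, block_index K (p i) = block_index K i) (p \in block_stab K).
Proof. by rewrite inE; apply: (iffP forallP) => H i; apply/eqP; apply: H. Qed.

Lemma block_stab1 K : 1%g \in block_stab K.
Proof. by apply/block_stabP => i; rewrite perm1. Qed.

Lemma block_stabM K p q :
  p \in block_stab K -> q \in block_stab K -> (p * q)%g \in block_stab K.
Proof.
by move=> /block_stabP Kp /block_stabP Kq; apply/block_stabP => i; rewrite permM Kq Kp.
Qed.

Lemma block_stabV K p : (p^-1%g \in block_stab K) = (p \in block_stab K).
Proof.
by apply/block_stabP/block_stabP => Kp i;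
  [rewrite -{2}(permK p i) Kp | rewrite -{2}(permKV p i) Kp].
Qed.

Lemma block_stabMl K p q : p \in block_stab K ->
  ((p * q)%g \in block_stab K) = (q \in block_stab K).
Proof.
move=> Kp; apply/idP/idP => [Kpq|]; last exact: block_stabM.
by rewrite -(mulKg p q) block_stabM ?block_stabV.
Qed.

Lemma block_stab_sub U V : U \subset V -> block_stab V \subset block_stab U.
Proof.
move=> sUV; apply/subsetP => p /block_stabP Vp; apply/block_stabP => i.
(* An element of U between a and b would also lie in V and force the V-indices of a and b apart. *)
have suff_lt (a b : nat) : (a <= b)%N -> block_index V a = block_index V b ->
    block_index U a = block_index U b.
  move=> le_ab eqV; apply: eq_card => u; rewrite !inE.
  have [Uu /= | //] := boolP (u \in U).
  apply/idP/idP => [/leq_trans | lt_ub]; first exact.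
  rewrite ltnNge; apply/negP => le_au.
  have : (block_index V a < block_index V b)%N; last by rewrite eqV ltnn.
  apply: (leq_trans _ (leq_block_index V lt_ub)).
  by rewrite block_indexS (subsetP sUV) // addn1 ltnS leq_block_index.
case: (leqP (p i) i) => [|/ltnW] le_pi; first exact: suff_lt (Vp i).
by apply/esym/suff_lt/esym/Vp.
Qed.

Lemma adj_tperm_block_stab K (u : 'I_N) : u \notin K ->
  tperm (widen_ord (leqnSn N) u) (lift ord0 u) \in block_stab K.
Proof.
move=> nKu; apply/block_stabP => i.
have eqK : block_index K (lift ord0 u) = block_index K (widen_ord (leqnSn N) u).
  by rewrite /= /bump add1n block_indexS (negPf nKu) addn0.
by case: tpermP => [-> | -> |].
Qed.

Lemma adj_tperm_lex_lt w (u : 'I_N) : u \in descents w ->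
  lex_lt (tperm (widen_ord (leqnSn N) u) (lift ord0 u) * w)%g w.
Proof.
rewrite inE => desc_u; apply/lex_ltP; exists (widen_ord (leqnSn N) u) => [j lt_ju|].
  by rewrite permM tpermD // -val_eqE /= /bump; apply/eqP => /= eqj; move: lt_ju;
    rewrite -eqj /=; lia.
by rewrite permM tpermL.
Qed.

Lemma block_stab_moved K p : p \in block_stab K -> p != 1%g ->
  exists i, [/\ forall j, (j < i)%N -> p j = j, (i < p i)%N
              & block_index K i = block_index K (p i)].
Proof.
move=> /block_stabP Kp p1.
have [i0 pi0] : exists i, p i != i.
  apply/existsP; rewrite -negb_forall; apply: contra p1 => /forallP fixp.
  by apply/eqP/permP => i; rewrite perm1; apply/eqP.
case: (@arg_minnP _ i0 (fun i => p i != i) (fun i => i : nat) pi0) => i pi min_i.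
have fixp j : (j < i)%N -> p j = j.
  by move=> lt_ji; apply/eqP; apply: contraLR lt_ji => /min_i; rewrite -leqNgt.
exists i; split=> //; rewrite ltn_neqAle eq_sym pi /= leqNgt.
by apply/negP => /fixp/perm_inj /eqP; rewrite (negPf pi).
Qed.

(** The first point moved by p goes to the right inside its block, where w increases. For w
    decreasing on the blocks the inequality is reversed ([lex_lt_antisorted_blocks]). *)
Lemma lex_lt_sorted_blocks K p w :
  p \in block_stab K -> p != 1%g -> descents w \subset K -> lex_lt w (p * w)%g.
Proof.
move=> Kp p1 /subsetP sortedw; have [i [fixp lt_ip eqK]] := block_stab_moved Kp p1.
apply/lex_ltP; exists i => [j /fixp|]; rewrite permM; first by move->.
apply: (homo_same_block (e := ltn) (f := fun j => w j) ltn_trans _ lt_ip eqK) => u.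
move=> /(contra (sortedw u)); rewrite inE -leqNgt leq_eqVlt => /orP[|//].
by move/eqP/val_inj/perm_inj/(congr1 val) => /=; rewrite /bump; lia.
Qed.

Lemma lex_lt_antisorted_blocks K p w :
  p \in block_stab K -> p != 1%g -> ~: descents w \subset K -> lex_lt (p * w)%g w.
Proof.
move=> Kp p1 /subsetP sortedw; have [i [fixp lt_ip eqK]] := block_stab_moved Kp p1.
apply/lex_ltP; exists i => [j /fixp|]; rewrite permM; first by move->.
apply: (homo_same_block (e := gtn) (f := fun j => w j) _ _ lt_ip eqK) => [y x z /= gt_xy|u].
  by move/ltn_trans; apply.
by move=> /(contra (sortedw u)); rewrite !inE negbK.
Qed.

End Blocks.

(** * Traces on submodules *)

(** B and [row_base U] are two bases of the same space, so the two matrices of g are conjugate. *)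
Lemma mxtrace_submod (F : fieldType) (gT : finGroupType) (G : {group gT}) n
    (rG : mx_representation F G n) (U : 'M_n) (modU : mxmodule rG U)
    r (B : 'M_(r, n)) (M : 'M_r) g :
  g \in G -> row_free B -> (B :=: U)%MS -> B *m rG g = M *m B ->
  \tr (submod_mx modU g) = \tr M.
Proof.
move=> Gg freeB eqBU BgM.
have /submxP[Y defB] : (B <= row_base U)%MS by rewrite eq_row_base eqBU.
have /submxP[X defU] : (row_base U <= B)%MS by rewrite eq_row_base eqBU.
have XY1 : X *m Y = 1%:M.
  by apply/(row_free_inj (row_base_free U)); rewrite -mulmxA -defB -defU mul1mx.
have := val_submodJ modU (1%:M : 'M_(\rank U)) Gg.
rewrite /val_submod /= !mul1mx; move: (submod_mx modU g) => S base_g.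
have -> : M = Y *m S *m X.
  by apply/(row_free_inj freeB); rewrite -BgM -!mulmxA -defU base_g mulmxA -defB.
by rewrite mxtrace_mulC mulmxA XY1 mul1mx.
Qed.

(* The trace on the row space of E can be read off the action on its column   *)
(* space, since both are given by the same matrix M once E = C *m B has full  *)
(* rank r.                                                                    *)
Lemma mxtrace_submod_col (F : fieldType) (gT : finGroupType) (G : {group gT}) n
    (rG : mx_representation F G n) (U : 'M_n) (modU : mxmodule rG U)
    (E : 'M_n) r (C : 'M_(n, r)) (B : 'M_(r, n)) (M : 'M_r) g :
  g \in G -> (E :=: U)%MS -> E = C *m B -> (r <= \rank E)%N ->
  rG g *m E = E *m rG g -> rG g *m C = C *m M ->
  \tr (submod_mx modU g) = \tr M.
Proof.
move=> Gg eqEU defE rankE comE CM.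
have rankB : \rank B = r.
  by apply/eqP; rewrite eqn_leq rank_leq_row (leq_trans rankE) // defE mxrankM_maxr.
have freeC : row_free C^T.
  by rewrite /row_free mxrank_tr eqn_leq rank_leq_col (leq_trans rankE) // defE mxrankM_maxl.
have eqBE : (B :=: E)%MS.
  apply/eqmx_sym/eqmxP; rewrite -(geq_leqif (mxrank_leqif_eq _)) ?rankB //.
  by rewrite defE submxMl.
apply: (mxtrace_submod modU Gg (B := B)); first by rewrite /row_free rankB.
  exact: eqmx_trans eqBE eqEU.
apply: trmx_inj; apply: (row_free_inj freeC); rewrite -!trmx_mul; congr (_^T).
by rewrite !mulmxA -defE -comE defE mulmxA CM.
Qed.

(** * Solomon's basis of functions on the group *)

Section Solomon.

Variable N : nat.
Local Notation T := 'S_N.+1.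
Local Notation G := [set: T]%G.
Local Notation ix := (gring_index G).
Implicit Types (K U V : {set 'I_N}) (w p g h : T).

Lemma gring_indexTK : cancel ix (@enum_val _ G).
Proof. by move=> w; rewrite gring_indexK ?inE. Qed.

Lemma sum_gring (F : 'I_#|G| -> algC) :
  \sum_i F i = \sum_(w : T) F (ix w).
Proof.
rewrite (reindex ix) //; exists (@enum_val _ G) => w _; last exact: gring_valK.
exact: gring_indexTK.
Qed.

(** On columns, [mulL_mx f *m A] at h is the sum over p of f p times A at p * h. These operators
    commute with right translations. *)
Definition mulL_mx (f : T -> algC) : 'M[algC]_#|G| :=
  \matrix_(i, j) f (enum_val j * (enum_val i)^-1)%g.

(* A column vector y is seen as a function on the group: right_mx g *m y is   *)
(* the function h |-> y (h * g).                                              *)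
Definition right_mx g : 'M[algC]_#|G| := regular_repr algC G g.

Lemma right_mxE g i j : right_mx g i j = (enum_val j == enum_val i * g)%g%:R.
Proof.
rewrite !mxE eqxx /= -(inj_eq (can_inj (gring_valK (G := G)))) gring_indexTK.
by rewrite eq_sym.
Qed.

Lemma mul_right_mx m g (A : 'M_(#|G|, m)) i j :
  (right_mx g *m A) i j = A (ix (enum_val i * g)%g) j.
Proof.
rewrite mxE (bigD1 (ix (enum_val i * g)%g)) //= big1 => [|k nk].
  by rewrite right_mxE gring_indexTK eqxx mul1r addr0.
rewrite right_mxE -(inj_eq (can_inj gring_indexTK)) gring_valK (negPf nk).
by rewrite mul0r.
Qed.

Lemma mul_mx_right m g (A : 'M_(m, #|G|)) i j :
  (A *m right_mx g) i j = A i (ix (enum_val j * g^-1)%g).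
Proof.
rewrite mxE (bigD1 (ix (enum_val j * g^-1)%g)) //= big1 => [|k nk].
  by rewrite right_mxE gring_indexTK mulgKV eqxx mulr1 addr0.
rewrite right_mxE -(inj_eq (mulIg g^-1%g)) mulgK -(inj_eq (can_inj gring_indexTK)).
by rewrite gring_valK eq_sym (negPf nk) mulr0.
Qed.

Lemma mulL_mx_right f g : mulL_mx f *m right_mx g = right_mx g *m mulL_mx f.
Proof.
apply/matrixP => i j; rewrite mul_mx_right mul_right_mx !mxE !gring_indexTK.
by rewrite invMg mulgA.
Qed.

(** Column w is the indicator of the coset S_(Des w) w, whose lexicographically least element is w,
    since w increases between its descents. *)
Definition basis_mx : 'M[algC]_#|G| :=
  \matrix_(i, j) (enum_val i * (enum_val j)^-1 \in
                    block_stab (descents (enum_val j)))%g%:R.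

Lemma basis_mx_lex h w : basis_mx (ix h) (ix w) != 0 -> h != w -> lex_lt w h.
Proof.
rewrite mxE !gring_indexTK pnatr_eq0 eqb0 negbK => stab_hw neq_hw.
rewrite -[h in lex_lt _ h](mulgKV w h); apply: (lex_lt_sorted_blocks stab_hw) => //.
by apply: contra neq_hw => /eqP hw1; rewrite -(mulgKV w h) hw1 mul1g.
Qed.

Lemma basis_mx_diag w : basis_mx (ix w) (ix w) = 1.
Proof. by rewrite mxE mulgV block_stab1. Qed.

Lemma basis_mx_unit : basis_mx \in unitmx.
Proof.
rewrite -unitmx_tr.
apply: (triangular_unitmx (ell := fun i => lex_rank (enum_val i))) => [i | i j].
  by rewrite mxE -(gring_valK i) basis_mx_diag oner_eq0.
rewrite mxE => neq_ij nz_ij; apply: lex_rank_lt.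
apply: basis_mx_lex; rewrite ?gring_valK //.
by rewrite eq_sym (inj_eq enum_val_inj).
Qed.

Definition left_invariant m V (A : 'M[algC]_(#|G|, m)) :=
  forall p h j, p \in block_stab V -> A (ix (p * h)%g) j = A (ix h) j.

Lemma left_invariantB m V (A B : 'M[algC]_(#|G|, m)) :
  left_invariant V A -> left_invariant V B -> left_invariant V (A - B).
Proof. by move=> Ainv Binv p h j Vp; rewrite !mxE Ainv ?Binv. Qed.

Lemma left_invariantM m k V (A : 'M_(#|G|, m)) (B : 'M[algC]_(m, k)) :
  left_invariant V A -> left_invariant V (A *m B).
Proof.
by move=> Ainv p h j Vp; rewrite !mxE; apply: eq_bigr => i _; rewrite Ainv.
Qed.

Lemma left_invariant_right m V g (A : 'M[algC]_(#|G|, m)) :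
  left_invariant V A -> left_invariant V (right_mx g *m A).
Proof.
by move=> Ainv p h j Vp; rewrite !mul_right_mx !gring_indexTK -mulgA Ainv.
Qed.

(* If w is a lexicographically minimal index with descents w not in V and a   *)
(* nonzero coordinate, the part of A on such indices takes the same value at  *)
(* w and at s * w, where s \in block_stab V exchanges the two positions of a  *)
(* descent of w outside V; it vanishes at s * w, which is smaller than w.     *)
Lemma basis_coord_invariant m V (A : 'M[algC]_(#|G|, m)) w j :
  left_invariant V A -> ~~ (descents w \subset V) ->
  (invmx basis_mx *m A) (ix w) j = 0.
Proof.
move=> Ainv badw; set X := invmx basis_mx *m A.
pose bad (i : 'I_#|G|) := ~~ (descents (enum_val i) \subset V).
pose Y : 'M_(#|G|, m) := \matrix_(i, k) (if bad i then X i k else 0).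
pose Z : 'M_(#|G|, m) := \matrix_(i, k) (if bad i then 0 else X i k).
have XYZ : A = basis_mx *m Y + basis_mx *m Z.
  rewrite -mulmxDr -{1}(mulKVmx basis_mx_unit A) -/X; congr (_ *m _).
  by apply/matrixP => i k; rewrite !mxE; case: ifP; rewrite ?addr0 ?add0r.
have Yinv : left_invariant V (basis_mx *m Y).
  rewrite -[_ *m Y](addrK (basis_mx *m Z)) -XYZ; apply: left_invariantB => //.
  move=> p h k Vp; rewrite !mxE; apply: eq_bigr => i _; rewrite !mxE.
  case: ifP => [|/negbFE sDV]; first by rewrite !mulr0.
  rewrite !gring_indexTK -mulgA block_stabMl //.
  exact: (subsetP (block_stab_sub sDV)).
have [m' lewm] := ubnP (lex_rank w); elim: m' w lewm badw => // m' IH w lewm badw.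
have Ybig h : (lex_rank h < m')%N -> (basis_mx *m Y) (ix h) j = 0.
  move=> lehm; rewrite mxE sum_gring big1 // => x _; rewrite [Y _ _]mxE /bad gring_indexTK.
  case: ifP => [badx|_]; last by rewrite mulr0.
  have [-> | nz] := eqVneq (basis_mx (ix h) (ix x)) 0; first by rewrite mul0r.
  rewrite IH ?mulr0 //; have [<- // | /(basis_mx_lex nz)/lex_rank_lt lt_xh] := eqVneq h x.
  exact: ltn_trans lehm.
have [u uD nVu] := subsetPn badw.
have := Yinv _ w j (adj_tperm_block_stab nVu).
rewrite Ybig => [|]; last exact: leq_trans (lex_rank_lt (adj_tperm_lex_lt uD)) _.
rewrite mxE sum_gring (bigD1 w) //= big1 => [|x neq_xw].
  by rewrite basis_mx_diag mul1r [Y _ _]mxE /bad gring_indexTK badw addr0.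
rewrite [Y _ _]mxE /bad gring_indexTK; case: ifP => [badx|_]; last by rewrite mulr0.
have [-> | nz] := eqVneq (basis_mx (ix w) (ix x)) 0; first by rewrite mul0r.
rewrite IH ?mulr0 //; rewrite eq_sym in neq_xw.
exact: leq_trans (lex_rank_lt (basis_mx_lex nz neq_xw)) _.
Qed.

Definition act_mx g := invmx basis_mx *m right_mx g *m basis_mx.

Definition descent_trace U g : algC :=
  \sum_(w : T | descents w == U) act_mx g (ix w) (ix w).

Lemma descent_trace1 U : descent_trace U 1%g = #|[set w | descents w == U]|%:R.
Proof.
have act1 : act_mx 1%g = 1%:M.
  by rewrite /act_mx /right_mx repr_mx1 mulmx1 mulVmx ?basis_mx_unit.
rewrite /descent_trace act1 -[in RHS]sum1_card natr_sum.
by apply: eq_big => [w | w _]; rewrite ?inE // mxE eqxx.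
Qed.

Lemma basis_col_invariant V w : descents w \subset V ->
  left_invariant V (col (ix w) basis_mx).
Proof.
move=> sDV p h j Vp; rewrite !mxE !gring_indexTK -mulgA block_stabMl //.
exact: (subsetP (block_stab_sub sDV)).
Qed.

(** Right translation preserves left S_V-invariance, so [act_mx g] is block triangular for inclusion
    of descent sets. *)
Lemma act_mx_eq0 V g x w :
  descents w \subset V -> ~~ (descents x \subset V) -> act_mx g (ix x) (ix w) = 0.
Proof.
move=> sDV badx; have := basis_coord_invariant 0
  (left_invariant_right g (basis_col_invariant sDV)) badx.
by rewrite colE !mulmxA -colE mxE.
Qed.

Definition sym_mx V := mulL_mx (fun p => (p \in block_stab V)%:R).

Lemma sym_mx_invariant V : left_invariant V (sym_mx V).
Proof.
move=> p h j Vp; rewrite !mxE !gring_indexTK -block_stabV -[in RHS]block_stabV.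
by rewrite !invMg !invgK -!mulgA block_stabMl.
Qed.

Lemma sym_mxM m V (A : 'M_(#|G|, m)) : left_invariant V A ->
  sym_mx V *m A = #|block_stab V|%:R *: A.
Proof.
move=> Ainv; apply/matrixP => i j; rewrite !mxE sum_gring.
rewrite -(gring_valK i) -[in RHS]sum1_card natr_sum mulr_suml.
rewrite (reindex_inj (mulIg (enum_val i))) /= [RHS]big_mkcond /=.
apply: eq_bigr => p _; rewrite !mxE !gring_indexTK mulgK.
by case: ifP => Vp; rewrite ?mul0r // Ainv.
Qed.

(** The trace of right translation composed with the symmetriser of S_V is computed twice: on the
    group elements, where it counts h with h g h^-1 in S_V, and in Solomon's basis. *)
Lemma sum_descent_trace V g :
  #|block_stab V|%:R * (\sum_(U : {set 'I_N} | U \subset V) descent_trace U g) =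
  #|[set h : T | (h * g * h^-1)%g \in block_stab V]|%:R.
Proof.
pose S := right_mx g *m sym_mx V.
have -> : #|[set h : T | (h * g * h^-1)%g \in block_stab V]|%:R = \tr S.
  rewrite /mxtrace sum_gring -[in LHS]sum1_card natr_sum big_mkcond /=.
  apply: eq_bigr => h _; rewrite inE mul_right_mx mxE !gring_indexTK.
  by rewrite -[in RHS]block_stabV !invMg !invgK; case: ifP.
have -> : \sum_(U : {set 'I_N} | U \subset V) descent_trace U g =
    \sum_(w : T | descents w \subset V) act_mx g (ix w) (ix w).
  rewrite [RHS](partition_big (@descents N) (fun U => U \subset V)) //=.
  apply: eq_bigr => U sUV; apply: eq_bigl => w.
  by case: eqP => [->|]; rewrite ?sUV ?andbF.
(* In Solomon's basis the symmetriser multiplies invariant columns by |S_V|, and its rows at indices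
   w with Des w not in V vanish. *)
pose Q := invmx basis_mx *m sym_mx V *m basis_mx.
have -> : \tr S = \tr (Q *m act_mx g).
  rewrite /Q /act_mx !mulmxA mulmxK ?basis_mx_unit // -!mulmxA [in RHS]mxtrace_mulC.
  by rewrite !mulmxA mulmxK ?basis_mx_unit // [in RHS]mxtrace_mulC.
rewrite /mxtrace sum_gring mulr_sumr [LHS]big_mkcond /=; apply: eq_bigr => w _.
case: ifPn => [sDV | badw].
  have := sym_mxM (left_invariant_right g (basis_col_invariant sDV)).
  move/(congr1 (fun A => (invmx basis_mx *m A) (ix w) 0)).
  rewrite /= colE -scalemxAr !mulmxA -!colE mxE => defQ.
  rewrite /act_mx mulmxK ?basis_mx_unit // defQ.
  by rewrite [RHS]mxE [in RHS]mxE.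
rewrite mxE big1 // => i _.
suff -> : Q (ix w) i = 0 by rewrite mul0r.
by rewrite /Q -mulmxA; apply: (basis_coord_invariant _ _ badw);
  apply/left_invariantM/sym_mx_invariant.
Qed.

End Solomon.

(** * The Specht module of a ribbon *)

Lemma mxrank_mxsub (F : fieldType) m n m' n' (f : 'I_m' -> 'I_m)
    (g : 'I_n' -> 'I_n) (A : 'M[F]_(m, n)) : (\rank (mxsub f g A) <= \rank A)%N.
Proof.
have -> : mxsub f g A = rowsub f (colsub g A) by apply/matrixP => i j; rewrite !mxE.
apply: leq_trans (mxrankS (rowsub_sub f _)) _.
rewrite -mxrank_tr -(mxrank_tr A).
have -> : (colsub g A)^T = rowsub g A^T by apply/matrixP => i j; rewrite !mxE.
exact: mxrankS (rowsub_sub g _).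
Qed.

Section SpechtModule.

Variables (N : nat) (U : {set 'I_N}).
Local Notation T := 'S_N.+1.
Local Notation G := [set: T]%G.
Local Notation ix := (gring_index G).
Implicit Types (w p g h : T).

(** Only steps outside U change the column of the ribbon, so [block_stab (~: U)] is its column group
    ([col_stab_ribbon]). *)
Definition alternating p : algC :=
  if p \in block_stab (~: U) then (-1) ^+ (p : bool) else 0.

Lemma alternating_adj_tperm (u : 'I_N) p : u \in U ->
  alternating (tperm (widen_ord (leqnSn N) u) (lift ord0 u) * p)%g = - alternating p.
Proof.
move=> Uu; rewrite /alternating block_stabMl; last first.
  by apply: adj_tperm_block_stab; rewrite inE Uu.
case: ifP => _; last by rewrite oppr0.
by rewrite odd_permM odd_tperm signr_addb -val_eqE /= /bump add1n neq_ltn ltnSn expr1 mulN1r.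
Qed.

Definition specht_mx := mulL_mx alternating *m sym_mx U.

Lemma specht_mx_right g : right_mx g *m specht_mx = specht_mx *m right_mx g.
Proof. by rewrite /specht_mx mulmxA -!mulL_mx_right -!mulmxA mulL_mx_right. Qed.

(** For u in U that is not a descent of w, the adjacent transposition at u fixes column w of the
    basis but changes the sign of [alternating]. *)
Lemma alternating_basis0 i w : descents w \proper U ->
  (mulL_mx alternating *m basis_mx N) i (ix w) = 0.
Proof.
case/properP=> _ [u Uu nDu]; set S := LHS.
pose s : T := tperm (widen_ord (leqnSn N) u) (lift ord0 u).
suff eqS : S = - S.
  have : S *+ 2 == 0 by rewrite mulr2n {2}eqS subrr.
  by rewrite mulrn_eq0 => /eqP.
rewrite {1}/S mxE sum_gring (reindex_inj (mulgI s)) /S mxE sum_gring -sumrN.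
apply: eq_bigr => z _; rewrite !mxE !gring_indexTK -!mulgA.
by rewrite alternating_adj_tperm // block_stabMl ?mulNr // adj_tperm_block_stab.
Qed.

Let D := [set w | descents w == U].
Let idx (i : 'I_#|D|) := ix (enum_val i).

Lemma alternating_basis_mul m (A : 'M_(#|G|, m)) :
  (forall w j, ~~ (descents w \subset U) -> A (ix w) j = 0) ->
  mulL_mx alternating *m basis_mx N *m A =
  colsub idx (mulL_mx alternating *m basis_mx N) *m rowsub idx A.
Proof.
move=> A0; apply/matrixP => i j; rewrite !mxE sum_gring.
under [RHS]eq_bigr => k _ do rewrite [colsub _ _ _ _]mxE [rowsub _ _ _ _]mxE.
rewrite -(big_enum_val (fun w => _ i (ix w) * A (ix w) j)) /=.
rewrite [RHS]big_mkcond /=; apply: eq_bigr => w _; rewrite inE.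
have [// | neqU] := eqVneq (descents w) U.
have [sDU | badw] := boolP (descents w \subset U); last by rewrite A0 ?mulr0.
by rewrite alternating_basis0 ?mul0r // properEneq neqU.
Qed.

(** A nonzero term z of the product satisfies k <= z <= h: z differs from h by a column permutation,
    and h decreases along columns; z differs from k by a row permutation, and k increases along
    rows. *)
Lemma specht_mx_lex h k : descents h = U -> descents k = U ->
  specht_mx (ix h) (ix k) != 0 -> h != k -> lex_lt k h.
Proof.
move=> Dh Dk nz neq_hk; have [z nzz] : exists z,
    mulL_mx alternating (ix h) (ix z) * sym_mx U (ix z) (ix k) != 0.
  apply/existsP; apply: contraR nz; rewrite negb_exists => /forallP all0.
  by rewrite mxE sum_gring big1 // => z _; apply/eqP; rewrite -[_ == _]negbK.
move: nzz; rewrite !mxE !gring_indexTK mulf_eq0 negb_or pnatr_eq0 eqb0 negbK.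
rewrite /alternating; case: ifP => [alt_zh /andP[_ sym_kz] | _]; last by rewrite eqxx.
have le_zh : z != h -> lex_lt z h.
  move=> neq_zh; rewrite -[z in lex_lt z _](mulgKV h).
  apply: lex_lt_antisorted_blocks alt_zh _ _; last by rewrite Dh.
  by rewrite -eq_mulgV1.
have le_kz : k != z -> lex_lt k z.
  move=> neq_kz; rewrite -[z in lex_lt _ z](mulgKV k).
  apply: lex_lt_sorted_blocks (_ : _ \in block_stab U) _ _; last by rewrite Dk.
    by rewrite -block_stabV invMg invgK.
  by rewrite -eq_mulgV1 eq_sym.
have [eq_zh | /le_zh lt_zh] := eqVneq z h; first by rewrite -eq_zh le_kz // eq_zh eq_sym.
have [-> // | neq_kz] := eqVneq k z.
exact: lex_lt_trans (le_kz neq_kz) lt_zh.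
Qed.

Lemma specht_mx_diag h : descents h = U -> specht_mx (ix h) (ix h) = 1.
Proof.
move=> Dh; rewrite mxE sum_gring (bigD1 h) //= big1 => [|z neq_zh].
  by rewrite !mxE !gring_indexTK mulgV /alternating !block_stab1 odd_perm1 mulr1 addr0.
rewrite !mxE !gring_indexTK /alternating; case: ifP => [alt_zh|]; last by rewrite mul0r.
case: (boolP (_ \in _)) => [sym_hz | _]; last by rewrite mulr0.
have lt_zh : lex_lt z h.
  rewrite -[z in lex_lt z _](mulgKV h).
  by apply: lex_lt_antisorted_blocks alt_zh _ _; rewrite ?Dh // -eq_mulgV1.
have lt_hz : lex_lt h z.
  rewrite -[z in lex_lt _ z](mulgKV h).
  apply: lex_lt_sorted_blocks (_ : _ \in block_stab U) _ _; rewrite ?Dh //.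
    by rewrite -block_stabV invMg invgK.
  by rewrite -eq_mulgV1.
by have := lex_lt_trans lt_zh lt_hz; rewrite lex_ltxx.
Qed.

(** Triangularity on the indices with descent set U supplies the rank bound that
    [mxtrace_submod_col] requires. *)
Lemma rank_specht_mx : (#|D| <= \rank specht_mx)%N.
Proof.
have Du i : descents (@enum_val _ D i) = U by have := enum_valP i; rewrite inE => /eqP.
suff /mxrank_unit <- : mxsub idx idx specht_mx \in unitmx by apply: mxrank_mxsub.
rewrite -unitmx_tr.
apply: (triangular_unitmx (ell := fun i => lex_rank (enum_val i))) => [i | i j].
  by rewrite 2!mxE specht_mx_diag ?oner_eq0.
rewrite 2!mxE => neq_ij nz; apply/lex_rank_lt/(specht_mx_lex _ _ nz) => //.
by rewrite (inj_eq enum_val_inj) eq_sym.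
Qed.

(** Expanding the symmetriser in Solomon's basis, indices with descents outside U have coordinate 0,
    and those strictly inside U are killed by the antisymmetriser. What remains factors
    [specht_mx U] through the block Des w = U, on which g acts by that block of [act_mx g]. *)
Lemma mxtrace_specht_submod (W : 'M_#|G|) (modW : mxmodule (regular_repr algC G) W) g :
  (specht_mx :=: W)%MS -> \tr (submod_mx modW g) = descent_trace U g.
Proof.
move=> eqW.
pose Z := invmx (basis_mx N) *m sym_mx U.
pose C := colsub idx (mulL_mx alternating *m basis_mx N).
have badZ w j : ~~ (descents w \subset U) -> Z (ix w) j = 0.
  by move=> badw; apply: (basis_coord_invariant _ _ badw); apply: sym_mx_invariant.
rewrite (mxtrace_submod_col (C := C) (B := rowsub idx Z)
          (M := mxsub idx idx (act_mx g)) modW (in_setT g) eqW).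
- rewrite /mxtrace /descent_trace; under eq_bigr => i _ do rewrite mxE.
  rewrite -(big_enum_val (fun w => act_mx g (ix w) (ix w))) /=.
  by apply: eq_bigl => w; rewrite inE.
- rewrite -alternating_basis_mul // /Z mulmxA mulmxK ?basis_mx_unit //.
- exact: rank_specht_mx.
- exact: specht_mx_right.
have act0 w j : ~~ (descents w \subset U) -> colsub idx (act_mx g) (ix w) j = 0.
  move=> badw; rewrite mxE (act_mx_eq0 _ _ badw) //.
  by have := enum_valP j; rewrite inE => /eqP->.
have -> : mxsub idx idx (act_mx g) = rowsub idx (colsub idx (act_mx g)).
  by apply/matrixP => i j; rewrite !mxE.
rewrite -(alternating_basis_mul act0) !mulmx_colsub; congr (mxsub _ _ _).
by rewrite /act_mx !mulmxA -mulL_mx_right mulmxK ?basis_mx_unit.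
Qed.

End SpechtModule.

(** * Ribbon characters as descent traces *)

Section RibbonCharacter.

Variables (N : nat) (U : {set 'I_N}).
Local Notation T := 'S_N.+1.
Local Notation G := [set: T]%G.
Local Notation ix := (gring_index G).
Local Notation reg := (regular_repr algC G).
Implicit Types (w p g h : T).

Lemma ribbon_boxE (m : nat) : (m <= N)%N ->
  ribbon_box [pred i : nat | [exists u in U, i == u.+1]] m =
  ((block_index U m)%:Z, - (block_index (~: U) m)%:Z).
Proof.
elim: m => [|m IHm] lt_mN; first by rewrite !block_index0 oppr0.
rewrite /= IHm ?(ltnW lt_mN) //.
rewrite (block_indexS U (Ordinal lt_mN)) (block_indexS (~: U) (Ordinal lt_mN)) inE /=.
have -> : [exists u in U, m.+1 == u.+1] = (Ordinal lt_mN \in U).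
  apply/exists_inP/idP => [[u Uu /eqP[eq_mu]] | Um]; last by exists (Ordinal lt_mN).
  by rewrite (_ : Ordinal lt_mN = u) //; apply/val_inj.
by case: (_ \in U) => /=; congr (_, _); lia.
Qed.

Definition ribbon (m : 'I_N.+1) :=
  ribbon_box [pred i : nat | [exists u in U, i == u.+1]] m.

Lemma row_stab_ribbon : row_stab ribbon = block_stab U.
Proof.
apply/setP => p; rewrite !inE; apply: eq_forallb => m.
by rewrite /ribbon !ribbon_boxE -1?ltnS //.
Qed.

Lemma col_stab_ribbon : col_stab ribbon = block_stab (~: U).
Proof.
apply/setP => p; rewrite !inE; apply: eq_forallb => m.
by rewrite /ribbon !ribbon_boxE -1?ltnS //= eqr_opp.
Qed.

Lemma row_specht_mx h : row (ix h) (specht_mx U) = polytabloid ribbon *m reg h.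
Proof.
rewrite /polytabloid row_stab_ribbon col_stab_ribbon gring_row_mul -mulmxA.
apply/rowP => j; rewrite !mxE !sum_gring.
(* Replacing z by z^-1 * j makes z the row factor of the polytabloid and [q0] below its column
   factor. *)
rewrite (reindex_inj (inj_comp (mulIg (enum_val j)) invg_inj)) /=.
apply: eq_bigr => z _; rewrite mulrC; congr (_ * _).
  rewrite mxE !gring_indexTK invMg invgK mulKVg.
  rewrite /gring_row mxE summxE (eq_bigr (fun p => (z == p)%:R)) => [|p _]; last first.
    by rewrite right_mxE !gring_indexTK mul1g.
  have [Uz | nUz] := boolP (z \in _).
    rewrite (bigD1 z) //= eqxx big1 ?addr0 // => p /andP[_ npz].
    by rewrite eq_sym (negPf npz).
  rewrite big1 // => p Up; case: eqP => // eq_zp; move: nUz; by rewrite eq_zp Up.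
rewrite -[X in _ = (_ *m X) _ _]/(right_mx h) mul_mx_right summxE.
rewrite mxE !gring_indexTK -mulgA; set q0 := (z^-1 * _)%g.
rewrite (eq_bigr (fun q : T => (-1) ^+ (q : bool) * (q == q0)%:R)) => [|q _]; last first.
  rewrite mxE -/(right_mx q) right_mxE !gring_indexTK; congr (_ * _%:R).
  by rewrite eq_sym /q0 -[in RHS](inj_eq (mulgI z)) mulKVg.
rewrite /alternating; have [Uq | nUq] := boolP (q0 \in _).
  rewrite (bigD1 q0) //= eqxx mulr1 big1 ?addr0 // => q /andP[_ nq].
  by rewrite (negPf nq) mulr0.
rewrite big1 // => q Uq; case: eqP => [eq_q | _]; last by rewrite mulr0.
by move: nUq; rewrite -eq_q Uq.
Qed.

Lemma specht_mx_cyclic : (specht_mx U :=: cyclic_mx reg (polytabloid ribbon))%MS.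
Proof.
apply/eqmxP/andP; split.
  apply/row_subP => i; rewrite -(gring_valK i) row_specht_mx.
  by apply: mxmodule_trans (cyclic_mx_module _ _) (in_setT _) (cyclic_mx_id _ _).
apply: cyclic_mx_sub.
  by apply/mxmoduleP => g _; rewrite -[reg g]/(right_mx g) -specht_mx_right submxMl.
by rewrite -[polytabloid _]mulmx1 -(repr_mx1 reg) -row_specht_mx row_sub.
Qed.

Lemma ribbon_charE g : ribbon_char (n := N.+1) U g = descent_trace U g.
Proof.
by rewrite cfunE /= in_setT mulr1n (mxtrace_specht_submod _ _ specht_mx_cyclic).
Qed.

End RibbonCharacter.

(** * Counting colourings fixed by a permutation *)

Lemma card_porbits_fun n r (g : 'S_n) :
  #|[set f : {ffun 'I_n -> 'I_r.+1} | [forall x, f (g x) == f x]]| =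
  (r.+1 ^ #|porbits g|)%N.
Proof.
pose F (c : {ffun {set 'I_n} -> 'I_r.+1}) := [ffun x : 'I_n => c (porbit g x)].
(* Functions on sets are normalised to [ord0] off the cycles of g, so that a colouring determines
   its preimage under F. *)
rewrite -[r.+1 in RHS]card_ord -(card_pffun_on ord0) -(card_in_imset (f := F)).
  apply: eq_card => f; rewrite inE; apply/forallP/imsetP => [fg | [c _ def_f]].
    have fgn i x : f ((g ^+ i)%g x) = f x.
      by elim: i => [|i IHi]; rewrite ?perm1 // expgSr permM (eqP (fg _)).
    exists [ffun A : {set 'I_n} => if [pick x in A] is Some x then
              (if A \in porbits g then f x else ord0) else ord0].
      apply/pffun_onP; split=> [|y _ //].
      by apply/supportP => A nA; rewrite ffunE (negPf nA); case: pickP.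
    apply/ffunP => x; rewrite !ffunE imset_f ?inE //.
    case: pickP => [y /porbitPmin[i _ ->] | /(_ x)]; last by rewrite porbit_id.
    by rewrite fgn.
  move=> x; rewrite def_f !ffunE; apply/eqP; congr (c _).
  exact: (porbit_perm g 1 x).
move=> c d /pffun_onP[/supportP c0 _] /pffun_onP[/supportP d0 _] /ffunP eq_cd.
apply/ffunP => A; have [/imsetP[x _ ->] | nA] := boolP (A \in porbits g).
  by have := eq_cd x; rewrite !ffunE.
by rewrite c0 ?d0.
Qed.

Section SortedColourings.

Variables (N r : nat).
Local Notation colouring := {ffun 'I_N.+1 -> 'I_r.+1}.
Implicit Types (s f : colouring) (h p : 'S_N.+1) (U : {set 'I_N}).

Lemma homo_ord_step (e : rel nat) (F : 'I_N.+1 -> nat) : transitive e ->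
  (forall u : 'I_N, e (F (widen_ord (leqnSn N) u)) (F (lift ord0 u))) ->
  forall i j : 'I_N.+1, (i < j)%N -> e (F i) (F j).
Proof.
move=> e_tr step i j lt_ij.
apply: (homo_same_block (K := set0) e_tr _ lt_ij) => [u _|]; first exact: step.
by rewrite /block_index !eq_card0 // => u; rewrite !inE.
Qed.

Definition sorted_colouring s :=
  [forall i : 'I_N.+1, forall j : 'I_N.+1, (i <= j)%N ==> (s i <= s j)%N].

Lemma sorted_colouringP s :
  reflect (forall i j : 'I_N.+1, (i <= j)%N -> (s i <= s j)%N) (sorted_colouring s).
Proof.
apply: (iffP forallP) => [sorted_s i j | sorted_s i].
  by move: (sorted_s i) => /forallP/(_ j)/implyP.
by apply/forallP => j; apply/implyP/sorted_s.
Qed.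

Definition breaks s : {set 'I_N} :=
  [set u : 'I_N | (s (widen_ord (leqnSn N) u) < s (lift ord0 u))%N].

Lemma eq_block_breaks s (i j : 'I_N.+1) : sorted_colouring s ->
  (block_index (breaks s) i == block_index (breaks s) j) = (s i == s j).
Proof.
move=> /sorted_colouringP sorted_s; wlog le_ij : i j / (i <= j)%N.
  move=> IH; case/orP: (leq_total i j) => /IH // eq_ji.
  by rewrite eq_sym eq_ji eq_sym.
move: le_ij; rewrite leq_eqVlt => /orP[/eqP/val_inj-> | lt_ij]; first by rewrite !eqxx.
apply/eqP/eqP => [eq_ij | eq_s].
  apply/val_inj/eqP.
  apply: (homo_same_block (e := eq_op) (f := fun i => s i : nat) _ _ lt_ij eq_ij).
    by move=> y x z /eqP->.
  move=> u; rewrite inE -leqNgt => le_u; rewrite eqn_leq le_u andbT.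
  by apply: sorted_s; rewrite /= /bump; lia.
apply: eq_card => u; rewrite !inE; case: ltnP => //= lt_su.
apply/idP/idP => [lt_ui | lt_uj]; first exact: ltn_trans lt_ij.
rewrite ltnNge; apply/negP => le_iu.
have := sorted_s i (widen_ord (leqnSn N) u) le_iu.
have := sorted_s (lift ord0 u) j; rewrite -eq_s /= /bump add1n => /(_ lt_uj).
by move: lt_su; lia.
Qed.

Lemma block_stab_breaks s p : sorted_colouring s ->
  (p \in block_stab (breaks s)) = [forall i : 'I_N.+1, s (p i) == s i].
Proof.
by move=> sorted_s; rewrite inE; apply: eq_forallb => i; rewrite eq_block_breaks.
Qed.

Definition permute h f : colouring := [ffun i => f (h i)].

Lemma permuteK h : cancel (permute h) (permute h^-1%g).
Proof. by move=> f; apply/ffunP => i; rewrite !ffunE permKV. Qed.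

Lemma permuteKV h : cancel (permute h^-1%g) (permute h).
Proof. by move=> f; apply/ffunP => i; rewrite !ffunE permK. Qed.

Lemma sorting_perm f : exists h, sorted_colouring (permute h f).
Proof.
pose le (a b : 'I_r.+1) := (a <= b)%N.
pose t := [tuple f i | i < N.+1].
have /tuple_permP[h def_t] : perm_eq (sort le t) t by rewrite perm_sort.
exists h; apply/sorted_colouringP => i j le_ij; rewrite !ffunE.
have nth_t (k : 'I_N.+1) : f (h k) = nth ord0 (sort le t) k.
  by rewrite def_t -tnth_nth !tnth_mktuple.
rewrite !nth_t; apply: (sorted_leq_nth (leT := le)) => //.
- by move=> a b c; apply: leq_trans.
- by apply: sort_sorted => a b; apply: leq_total.
- by rewrite inE size_sort size_tuple.
- by rewrite inE size_sort size_tuple.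
Qed.

Lemma sorted_permute_eq h s :
  sorted_colouring s -> sorted_colouring (permute h s) -> permute h s = s.
Proof.
pose le (a b : 'I_r.+1) := (a <= b)%N.
have sorted_codom f : sorted_colouring f -> sorted le (codom f).
  move=> /sorted_colouringP sorted_f; rewrite codomE.
  apply: (@homo_sorted _ _ f (fun i j : 'I_N.+1 => (i <= j)%N)) => //.
  by have := iota_sorted 0 N.+1; rewrite -val_enum_ord sorted_map.
move=> /sorted_codom sorted_s /sorted_codom sorted_hs.
have eq_codom : codom (permute h s) = codom s.
  apply: (sorted_eq (leT := le)) => //.
  - by move=> a b c; apply: leq_trans.
  - by move=> a b /andP[le_ab le_ba]; apply/val_inj/eqP; rewrite eqn_leq; apply/andP.
  rewrite !codomE (eq_map (g := s \o h)) => [|i]; last by rewrite ffunE.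
  rewrite map_comp perm_map // uniq_perm ?enum_uniq //.
    by rewrite map_inj_uniq ?enum_uniq //; apply: perm_inj.
  by move=> i; rewrite mem_enum inE -(permKV h i) mem_map ?mem_enum ?inE //; apply: perm_inj.
apply/ffunP => i; move/(congr1 (fun t => nth ord0 t i)): eq_codom.
by rewrite !codomE !(nth_map i) -?enumT ?size_enum_ord ?nth_ord_enum.
Qed.

(** The permutations sorting f form a coset of the stabiliser of its sorted rearrangement. *)
Lemma card_sorting_perms f h : sorted_colouring (permute h f) ->
  #|[set k | sorted_colouring (permute k f)]| = #|block_stab (breaks (permute h f))|.
Proof.
move=> sorted_hf; rewrite -[RHS](card_imset _ (mulIg h)); apply: eq_card => k.
have defk : (k = k * h^-1 * h)%g by rewrite mulgKV.
have permuteM p : permute (p * h)%g f = permute p (permute h f).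
  by apply/ffunP => i; rewrite !ffunE permM.
apply/idP/imsetP => [|[p stab_p ->]]; rewrite inE ?permuteM.
  rewrite {1}defk permuteM => sorted_k; exists (k * h^-1)%g => //.
  rewrite block_stab_breaks //; apply/forallP => i.
  by have /ffunP/(_ i) := sorted_permute_eq sorted_hf sorted_k; rewrite ffunE => ->.
suff -> : permute p (permute h f) = permute h f by [].
move: stab_p; rewrite block_stab_breaks // => /forallP fix_p.
by apply/ffunP => i; rewrite ffunE (eqP (fix_p i)).
Qed.

(** Pairs of a g-fixed colouring f and a permutation h sorting it are weighted by the inverse of the
    number of permutations sorting f, so each f counts once; the pairs are then regrouped by the
    sorted colouring s. *)
Lemma sum_sorted_colourings g :
  (r.+1 ^ #|porbits g|)%:R =
  \sum_(s | sorted_colouring s)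
    #|[set h : 'S_N.+1 | (h * g * h^-1)%g \in block_stab (breaks s)]|%:R /
    #|block_stab (breaks s)|%:R :> algC.
Proof.
have stab_neq0 s : #|block_stab (breaks s)|%:R != 0 :> algC.
  by rewrite pnatr_eq0 -lt0n; apply/card_gt0P; exists 1%g; apply: block_stab1.
pose X := [set f : colouring | [forall x, f (g x) == f x]].
rewrite -card_porbits_fun -/X -sum1_card natr_sum.
transitivity (\sum_(f in X) \sum_(h | sorted_colouring (permute h f))
    #|block_stab (breaks (permute h f))|%:R^-1 : algC).
  apply: eq_bigr => f _; have [h0 sorted_h0] := sorting_perm f.
  rewrite (eq_bigr (fun=> #|block_stab (breaks (permute h0 f))|%:R^-1)) => [|h sorted_h].
    rewrite sumr_const -(card_sorting_perms sorted_h0) cardsE -[RHS]mulr_natl divff //.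
    by rewrite -cardsE (card_sorting_perms sorted_h0).
  by rewrite -(card_sorting_perms sorted_h) (card_sorting_perms sorted_h0).
rewrite (exchange_big_dep xpredT) //=.
transitivity (\sum_(h : 'S_N.+1) \sum_(s | sorted_colouring s && (permute h^-1 s \in X))
    #|block_stab (breaks s)|%:R^-1 : algC).
  apply: eq_bigr => h _; rewrite (reindex (permute h^-1%g)) /=; last first.
    by exists (permute h) => f _; [apply: permuteKV | apply: permuteK].
  by apply: eq_big => [s | s _]; rewrite permuteKV 1?andbC.
rewrite (exchange_big_dep sorted_colouring) /= => [|h s _ /andP[] //].
apply: eq_bigr => s sorted_s.
rewrite (eq_bigl [in [set h : 'S_N.+1 | (h * g * h^-1)%g \in block_stab (breaks s)]]).
  by rewrite sumr_const -[LHS]mulr_natl.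
move=> h; rewrite /= sorted_s [RHS]inE block_stab_breaks // inE /=.
apply/forallP/forallP => fix_s i.
  by have := fix_s (h i); rewrite !ffunE !permM permK.
by have := fix_s (h^-1%g i); rewrite !ffunE !permM permKV.
Qed.

Lemma breaks_shift_step s U (u : 'I_N) : sorted_colouring s ->
  U \subset breaks s ->
  (s (widen_ord (leqnSn N) u) + block_index (~: U) u <
   s (lift ord0 u) + block_index (~: U) u.+1)%N.
Proof.
move=> /sorted_colouringP sorted_s /subsetP sUb; rewrite block_indexS inE.
have le_u : (s (widen_ord (leqnSn N) u) <= s (lift ord0 u))%N.
  by apply: sorted_s; rewrite /= /bump; lia.
by have [/sUb | _] := boolP (u \in U); rewrite ?inE /=; lia.
Qed.

(* Adding to s i the number of boundaries before i outside U makes s strictly *)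
(* increasing.                                                                *)
Lemma card_sorted_colourings U :
  #|[set s : colouring | sorted_colouring s & U \subset breaks s]| =
  'C(r + N.+1 - #|U|, N.+1).
Proof.
have leUN : (#|U| <= N)%N by rewrite -[X in (_ <= X)%N](card_ord N) max_card.
have cardUC : #|~: U| = (N - #|U|)%N by rewrite cardsCs setCK card_ord.
have -> : (r + N.+1 - #|U| = (r + (N - #|U|)).+1)%N by lia.
set m := (r + (N - #|U|))%N; pose b (i : 'I_N.+1) := block_index (~: U) i.
have le_b i : (b i <= N - #|U|)%N.
  by rewrite -cardUC -block_index_max leq_block_index // -ltnS.
pose F s : N.+1.-tuple 'I_m.+1 := [tuple inord (s i + b i) | i < N.+1].
have F_val s i : tnth (F s) i = (s i + b i)%N :> nat.
  rewrite tnth_mktuple inordK //; have := ltn_ord (s i); have := le_b i.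
  by rewrite /m; lia.
have F_inj : injective F.
  move=> s t eqF; apply/ffunP => i; apply/val_inj/eqP.
  by rewrite /= -(eqn_add2r (b i)) -!F_val eqF.
rewrite -(card_imset _ F_inj) -card_ltn_sorted_tuples; apply: eq_card => t.
have sorted_tP : reflect
    (forall u : 'I_N, (tnth t (widen_ord (leqnSn N) u) < tnth t (lift ord0 u))%N)
    (t \in [set t : N.+1.-tuple 'I_m.+1 | sorted ltn (map val t)]).
  have sz : size (map val t) = N.+1 by rewrite size_map size_tuple.
  have nth_t (i : 'I_N.+1) : nth 0%N (map val t) i = tnth t i.
    by rewrite (nth_map ord0) ?size_tuple // -tnth_nth.
  rewrite inE; apply: (iffP (sortedP 0%N)); rewrite sz => step u.
    by have := step u; rewrite -!nth_t /= /bump add1n ltnS; apply.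
  rewrite ltnS => lt_uN; have := step (Ordinal lt_uN).
  by rewrite -!nth_t /= /bump add1n.
apply/imsetP/sorted_tP => [[s] | step].
  rewrite inE => /andP[sorted_s sUb] -> u; rewrite !F_val /b.
  by have := breaks_shift_step u sorted_s sUb; rewrite /= /bump add1n.
(* This bound makes the truncated subtraction in [d] below exact. *)
have le_bt i : (b i <= tnth t i)%N.
  case: i; elim=> [|i IHi] lt_iN; first by rewrite /b block_index0.
  have lt_iN' : (i < N.+1)%N by lia.
  have := step (Ordinal (lt_iN : (i < N)%N)); have := IHi lt_iN'.
  rewrite /b /= (block_indexS _ (Ordinal (lt_iN : (i < N)%N))) /=.
  rewrite (_ : widen_ord _ _ = Ordinal lt_iN'); last exact/val_inj.
  rewrite (_ : lift _ _ = Ordinal lt_iN); last exact/val_inj.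
  by case: (_ \in _) => /=; lia.
pose d i := (tnth t i - b i)%N.
have step_d u : (d (widen_ord (leqnSn N) u) + (u \in U) <= d (lift ord0 u))%N.
  have := step u; have := le_bt (lift ord0 u); have := le_bt (widen_ord (leqnSn N) u).
  rewrite /d /b /= /bump add1n block_indexS inE.
  by case: (u \in U) => /=; lia.
have homo_d (i j : 'I_N.+1) : (i <= j)%N -> (d i <= d j)%N.
  rewrite leq_eqVlt => /orP[/eqP/val_inj-> // | lt_ij].
  apply: (homo_ord_step (e := leq)) lt_ij => [|u]; first exact: leq_trans.
  exact: leq_trans (leq_addr _ _) (step_d u).
have le_dr i : (d i <= r)%N.
  have le_iN : (i <= (ord_max : 'I_N.+1))%N by rewrite -ltnS.
  apply: leq_trans (homo_d i ord_max le_iN) _.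
  rewrite /d /b block_index_max cardUC; have := ltn_ord (tnth t ord_max).
  by rewrite /m; lia.
pose s : colouring := [ffun i => inord (d i)].
have s_val i : s i = d i :> nat by rewrite ffunE inordK // ltnS.
exists s; last first.
  by apply/eq_from_tnth => i; apply/val_inj; rewrite /= F_val s_val /d subnK.
rewrite inE; apply/andP; split.
  by apply/sorted_colouringP => i j /homo_d; rewrite !s_val.
by apply/subsetP => u Uu; rewrite inE !s_val; have := step_d u; rewrite Uu; lia.
Qed.

Theorem sum_descent_trace_bin g :
  \sum_(U : {set 'I_N}) descent_trace U g * 'C(r + N.+1 - #|U|, N.+1)%:R =
  (r.+1 ^ #|porbits g|)%:R.
Proof.
rewrite sum_sorted_colourings.
transitivity (\sum_(s | sorted_colouring s)
    \sum_(U : {set 'I_N} | U \subset breaks s) descent_trace U g).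
  rewrite (exchange_big_dep xpredT) //=; apply: eq_bigr => U _.
  by rewrite -card_sorted_colourings sumr_const cardsE mulr_natr.
apply: eq_bigr => s _; rewrite -sum_descent_trace mulrAC divff ?mul1r //.
by rewrite pnatr_eq0 -lt0n; apply/card_gt0P; exists 1%g; apply: block_stab1.
Qed.

End SortedColourings.

(** * Binomial sums and Eulerian polynomials *)

(* For deg p < n, this is the coefficient of t^r in p / (1 - t)^(n+1).        *)
Definition bin_form (n r : nat) (p : {poly algC}) : algC :=
  \sum_(d < n) p`_d * 'C(r + n - d, n)%:R.

(** Pascal's rule: the factor 1 - t cancels one factor of the denominator (1 - t)^(n+2). *)
Lemma bin_form_mul_oneBX n r (p : {poly algC}) : (size p <= n)%N ->
  bin_form n.+1 r (p * (1 - 'X)) = bin_form n r p.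
Proof.
move=> le_pn; rewrite /bin_form mulrBr mulr1.
under eq_bigr => d _ do rewrite coefB coefMX mulrBl.
rewrite sumrB big_ord_recr /= nth_default // mul0r addr0.
rewrite [X in _ - X]big_ord_recl /= mul0r add0r -sumrB.
apply: eq_bigr => d _; rewrite /bump add1n -mulrBr; congr (_ * _).
have -> : (r + n.+1 - d = (r + n - d).+1)%N by have := ltn_ord d; lia.
have -> : (r + n.+1 - d.+1 = r + n - d)%N by lia.
by rewrite binS natrD addrC addKr.
Qed.

Lemma size_mul_oneBXn k (p : {poly algC}) : (size (p * (1 - 'X) ^+ k)%R <= k + size p)%N.
Proof.
elim: k => [|k IHk]; first by rewrite mulr1.
rewrite exprSr mulrA; apply: leq_trans (size_polyMleq _ _) _.
have -> : size (1 - 'X : {poly algC}) = 2%N by rewrite -opprB size_polyN size_XsubC.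
by rewrite addn2 addSn.
Qed.

Lemma bin_form_mul_oneBXn n k r (p : {poly algC}) : (size p <= n)%N ->
  bin_form (k + n) r (p * (1 - 'X) ^+ k) = bin_form n r p.
Proof.
move=> le_pn; elim: k => [|k IHk]; first by rewrite mulr1.
rewrite addSn exprSr mulrA bin_form_mul_oneBX //.
by apply: leq_trans (size_mul_oneBXn _ _) _; rewrite leq_add2l.
Qed.

(** Taking r = d gives a triangular system: binom(d + n - i, n) is 1 for i = d and 0 for i > d. *)
Lemma bin_form_inj n (p q : {poly algC}) : (size p <= n)%N -> (size q <= n)%N ->
  (forall r, bin_form n r p = bin_form n r q) -> p = q.
Proof.
move=> le_pn le_qn eq_pq; apply/polyP => d.
have [lt_dn | le_nd] := ltnP d n; last first.
  by rewrite !nth_default ?(leq_trans le_pn) ?(leq_trans le_qn).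
have [m lt_dm] := ubnP d; elim: m d lt_dm lt_dn => // m IHm d lt_dm lt_dn.
have := eq_pq d; rewrite /bin_form (bigD1 (Ordinal lt_dn)) //=.
rewrite [RHS](bigD1 (Ordinal lt_dn)) //=.
rewrite addKn binn !mulr1.
rewrite [X in _ + X = _](eq_bigr (fun i : 'I_n => q`_i * 'C(d + n - i, n)%:R)).
  by move/addIr.
move=> i; rewrite -val_eqE /= neq_ltn => /orP[lt_id | lt_di].
  by rewrite IHm //; lia.
by rewrite bin_small ?mulr0 //; lia.
Qed.

(** * Generating polynomials of descent traces *)

Section FoulkesValues.

Variable N : nat.
Implicit Types (g : 'S_N.+1).

Definition trace_poly g : {poly algC} :=
  \sum_(U : {set 'I_N}) descent_trace U g *: 'X^#|U|.

Lemma size_trace_poly g : (size (trace_poly g) <= N.+1)%N.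
Proof.
apply: (leq_trans (size_sum _ _ _)); apply/bigmax_leqP => U _.
apply: leq_trans (size_scale_leq _ _) _; rewrite size_polyXn ltnS.
by rewrite -[X in (_ <= X)%N](card_ord N) max_card.
Qed.

Lemma coef_trace_poly g (d : nat) :
  (trace_poly g)`_d = \sum_(U : {set 'I_N} | #|U| == d) descent_trace U g.
Proof.
rewrite coef_sum [RHS]big_mkcond /=; apply: eq_bigr => U _.
by rewrite coefZ coefXn eq_sym; case: eqP; rewrite ?mulr1 ?mulr0.
Qed.

Lemma bin_form_trace_poly r g :
  bin_form N.+1 r (trace_poly g) = (r.+1 ^ #|porbits g|)%:R.
Proof.
rewrite -sum_descent_trace_bin /bin_form.
have cardU (U : {set 'I_N}) : (#|U| < N.+1)%N.
  by rewrite ltnS -[X in (_ <= X)%N](card_ord N) max_card.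
rewrite [RHS](partition_big (fun U : {set 'I_N} => Ordinal (cardU U)) xpredT) //=.
apply: eq_bigr => d _; rewrite coef_trace_poly mulr_suml.
by apply: eq_big => [U | U /eqP->].
Qed.

Lemma desE (w : 'S_N.+1) : des w = #|descents w|.
Proof.
pose F (u : 'I_N) := (widen_ord (leqnSn N) u, lift ord0 u).
have F_inj : injective F by move=> u v [eq_uv _]; apply/val_inj.
rewrite /des -(card_imset _ F_inj); apply: eq_card => -[i j].
rewrite inE /=; apply/andP/imsetP => [[/eqP eq_j lt_w] | [u desc_u [-> ->]]].
  have lt_iN : (i < N)%N by have := ltn_ord j; rewrite eq_j ltnS.
  have -> : i = widen_ord (leqnSn N) (Ordinal lt_iN) by apply/val_inj.
  have eqj : j = lift ord0 (Ordinal lt_iN) by apply/val_inj; rewrite /= eq_j.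
  exists (Ordinal lt_iN); last by rewrite eqj.
  rewrite inE -eqj; by rewrite (_ : widen_ord _ _ = i) //; apply/val_inj.
by rewrite inE in desc_u.
Qed.

Lemma eulerian_trace_poly : eulerian N.+1 = trace_poly 1%g.
Proof.
rewrite /eulerian /trace_poly (partition_big (@descents N) xpredT) //=.
apply: eq_bigr => U _; rewrite descent_trace1.
rewrite (eq_bigr (fun=> 'X^#|U|)) => [|w /eqP <-]; last by rewrite desE.
by rewrite sumr_const scaler_nat cardsE.
Qed.

End FoulkesValues.

Lemma card_porbits1 n : #|porbits (1 : 'S_n)%g| = n.
Proof.
rewrite card_imset ?card_ord // => x y /eqP; rewrite eq_porbit_mem.
by case/porbitP => i ->; rewrite expg1n perm1.
Qed.

Lemma bin_form_eulerian n k r :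
  bin_form (k + n.+1) r (eulerian n.+1 * (1 - 'X) ^+ k) = (r.+1 ^ n.+1)%:R.
Proof.
rewrite eulerian_trace_poly bin_form_mul_oneBXn ?size_trace_poly //.
by rewrite bin_form_trace_poly card_porbits1.
Qed.

Lemma size_eulerian_mul n k : (size (eulerian n.+1 * (1 - 'X) ^+ k)%R <= k + n.+1)%N.
Proof.
apply: leq_trans (size_mul_oneBXn _ _) _.
by rewrite leq_add2l eulerian_trace_poly size_trace_poly.
Qed.

(** * Foulkes characters, Z_n and C_(n,r) *)

Section Foulkes.

Variable N : nat.
Local Notation n := N.+1.
Implicit Types (g : 'S_n).

Lemma card_porbits_gt0 g : (0 < #|porbits g|)%N.
Proof. by apply/card_gt0P; exists (porbit g ord0); apply: imset_f. Qed.

Lemma card_porbits_le g : (#|porbits g| <= n)%N.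
Proof. by rewrite -[X in (_ <= X)%N]card_ord leq_imset_card. Qed.

Definition cycle_index g : 'I_n := inord #|porbits g|.-1.

Lemma cycle_indexE g : (cycle_index g).+1 = #|porbits g|.
Proof.
rewrite inordK ?prednK ?card_porbits_gt0 //; exact: card_porbits_le.
Qed.

(** Starting from the identity, multiplying by a transposition of points in different cycles merges
    two cycles. *)
Lemma cycle_index_surj (m : 'I_n) : exists g, cycle_index g = m.
Proof.
suff [g card_g] : exists g, #|porbits g| = m.+1.
  by exists g; apply/val_inj/succn_inj; rewrite /= cycle_indexE.
have [k le_kN ->] : exists2 k, (k <= N)%N & m.+1 = (n - k)%N.
  by exists (N - m)%N; have := ltn_ord m; lia.
elim: k le_kN => [|k IHk] le_kN; first by exists 1%g; rewrite card_porbits1 subn0.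
have [g card_g] := IHk (ltnW le_kN).
have [x nx] : exists x, x \notin porbit g ord0.
  apply/existsP; apply: contraTT isT; rewrite negb_exists => /forallP all0.
  have : (#|porbits g| <= #|[set porbit g ord0]|)%N.
    apply/subset_leq_card/subsetP => _ /imsetP[x _ ->]; rewrite inE.
    by rewrite eq_porbit_mem -[_ \in _]negbK.
  by rewrite card_g cards1; lia.
exists (tperm ord0 x * g)%g.
have := porbits_mul_tperm g ord0 x; rewrite /= card_g porbit_sym nx.
have -> : ord0 != x by apply: contraNneq nx => <-; apply: porbit_id.
by rewrite addn2 addn1 => -[card_tg]; rewrite subnS -card_tg.
Qed.

Lemma trace_polyE g :
  trace_poly g = eulerian (cycle_index g).+1 * (1 - 'X) ^+ (n - (cycle_index g).+1).
Proof.
apply: (@bin_form_inj n); first exact: size_trace_poly.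
  by have := size_eulerian_mul (cycle_index g) (n - (cycle_index g).+1); rewrite subnK.
move=> r; have := bin_form_eulerian (cycle_index g) (n - (cycle_index g).+1) r.
by rewrite subnK // => ->; rewrite bin_form_trace_poly cycle_indexE.
Qed.

Lemma foulkesE (i : 'I_n) g : foulkes i g = (trace_poly g)`_(n - i.+1).
Proof.
rewrite coef_trace_poly sum_cfunE; apply: eq_bigr => U _; exact: ribbon_charE.
Qed.

Lemma foulkes_rev (j : 'I_n) g : foulkes (rev_ord j) g = Zmx n j (cycle_index g).
Proof.
rewrite foulkesE mxE trace_polyE; congr (_`_ _).
by have := ltn_ord j; rewrite /=; lia.
Qed.

(** By Worpitzky's identity, multiplying by a binomial matrix gives the entries (r+1)^(i+1), a
    Vandermonde matrix with nonzero scaling. *)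
Lemma Zmx_unit : Zmx n \in unitmx.
Proof.
pose a : 'rV[algC]_n := \row_j j.+1%:R.
pose B : 'M[algC]_n := \matrix_(r, d) 'C(r + n - d, n)%:R.
suff : B *m Zmx n \in unitmx by rewrite unitmx_mul => /andP[].
have -> : B *m Zmx n = (Vandermonde n a *m diag_mx a)^T.
  apply/matrixP => r i; rewrite [RHS]mxE mul_mx_diag !mxE.
  rewrite -exprSr -natrX.
  have := bin_form_eulerian i (n - i.+1) r; rewrite subnK // => <-.
  by apply: eq_bigr => d _; rewrite !mxE mulrC.
rewrite unitmx_tr unitmx_mul !unitmxE det_Vandermonde det_diag !unitfE.
apply/andP; split; apply/prodf_neq0 => i _; last by rewrite mxE pnatr_eq0.
apply/prodf_neq0 => j lt_ij.
by rewrite !mxE subr_eq0 eqr_nat eqSS gtn_eqF.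
Qed.

Let phi := [tuple foulkes m | m < n].

(** The [coord] expansion is valid once the product lies in the span; it does, because its values
    depend only on the number of cycles and [Zmx n] is invertible. *)
Lemma foulkes_coef_sum (i j : 'I_n) g :
  \sum_k foulkes_coef i j k * foulkes k g = foulkes i g * foulkes j g.
Proof.
suff /coord_span def_ij : foulkes i * foulkes j \in <<phi>>%VS.
  have /cfunP/(_ g) := def_ij; rewrite cfunE => ->; rewrite sum_cfunE.
  by apply: eq_bigr => k _; rewrite cfunE -tnth_nth tnth_mktuple.
pose y : 'rV[algC]_n := \row_m (Zmx n (rev_ord i) m * Zmx n (rev_ord j) m).
pose u := y *m invmx (Zmx n).
suff -> : foulkes i * foulkes j = \sum_k u 0 k *: foulkes (rev_ord k).
  apply: memv_suml => k _; apply/memvZ/memv_span.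
  by apply/tnthP; exists (rev_ord k); rewrite tnth_mktuple.
apply/cfunP => h; rewrite cfunE [RHS]sum_cfunE.
have : y 0 (cycle_index h) = (u *m Zmx n) 0 (cycle_index h).
  by rewrite mulmxKV ?Zmx_unit.
rewrite mxE -!foulkes_rev !rev_ordK mxE => ->.
by apply: eq_bigr => k _; rewrite cfunE foulkes_rev.
Qed.

Lemma Cmx_mul_Zmx r : (0 < r)%N ->
  Cmx n r *m Zmx n = Zmx n *m diag_mx (\row_(i < n) (r%:R : algC) ^+ i.+1).
Proof.
(* Each column index m is realised by a permutation g; summing over k before j then collapses the
   structure constants into phi_(n+1-i)(g) phi_j(g). *)
move=> r_gt0; apply/matrixP => i m; have [g <-] := cycle_index_surj m.
rewrite mul_mx_diag [LHS]mxE [RHS]mxE [(\row_(_ < _) _) _ _]mxE.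
under eq_bigr => k _ do rewrite mxE mulr_suml -foulkes_rev.
rewrite exchange_big /= cycle_indexE -natrX -[in RHS](prednK r_gt0).
rewrite -bin_form_trace_poly /bin_form mulr_sumr [RHS](reindex_inj rev_ord_inj) /=.
apply: eq_bigr => j _.
rewrite (reindex_inj rev_ord_inj) /=.
under eq_bigr => k _ do rewrite rev_ordK mulrAC.
rewrite -mulr_suml foulkes_coef_sum foulkes_rev foulkesE mulrA.
congr (_ * 'C(_, _)%:R); have := ltn_ord j; lia.
Qed.

End Foulkes.

Theorem corollary4p6 (n r : nat) (hn : (0 < n)%N) (hr : (0 < r)%N) :
  invmx (Zmx n) *m Cmx n r *m Zmx n =
  diag_mx (\row_(i < n) (r%:R : algC) ^+ i.+1).
Proof.
by case: n hn => // N _; rewrite -mulmxA Cmx_mul_Zmx // mulKmx ?Zmx_unit.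
Qed.
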